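(* Let $G$ be a finite simple graph and $T$ an automorphism of $G$. Then the Lefschetz zeta function $\zeta_T(z)$ is a rational function.
   Context: For a finite simple graph $G=(V,E)$, a $k$-simplex is a complete subgraph $K_{k+1}$ of $G$ (identified with its vertex set). A $k$-form is a real-valued function $f(x_0,\dots,x_k)$ on ordered $k$-simplices that is antisymmetric in its $k+1$ arguments. The exterior derivative is $df(x_0,\dots,x_{k+1})=\sum_i (-1)^i f(x_0,\dots,\hat{x_i},\dots,x_{k+1})$. The cohomology group $H^k(G)$ is the real vector space of closed $k$-forms ($df=0$) modulo exact $k$-forms ($f=dg$). An automorphism $T$ induces by pull-back $f\mapsto f(T(\cdot),\dots,T(\cdot))$ a linear map $T_k$ on $H^k(G)$, and the Lefschetz number is $L(T)=\sum_{k\ge0}(-1)^k\mathrm{tr}(T_k)$. The Lefschetz zeta function of $T$ is $\zeta_T(z)=\exp\left(\sum_{n=1}^\infty L(T^n)\frac{z^n}{n}\right)$, viewed as a formal power series (or as an analytic function near $z=0$); the assertion is that it is the expansion at $0$ of a rational function of $z$. *)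

(* Defs.v *)
From HB Require Import structures.
From mathcomp Require Import all_boot all_order all_fingroup all_algebra.
From mathcomp Require Import reals.

Set Implicit Arguments.
Unset Strict Implicit.
Unset Printing Implicit Defensive.

Import GRing.Theory.

Local Open Scope ring_scope.
Local Open Scope quotient_scope.

Section VectorQuotient.
Variables (K : fieldType) (vT : vectType K) (U : {vspace vT}).

Definition vquot := Quotient.quot (pred_of_vspace U).
HB.instance Definition _ := GRing.Zmodule.on vquot.

Definition vclass (v : vT) : vquot := \pi v.
Definition vrepr (q : vquot) : vT := generic_quotient.repr q.

Lemma vreprK : cancel vrepr vclass.
Proof. exact: reprK. Qed.

Lemma vclass_eq (u v : vT) : (vclass u == vclass v) = (u - v \in U).
Proof. by rewrite [RHS]Quotient.idealrBE. Qed.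

Lemma vclassD : {morph vclass : u v / u + v}.
Proof. by move=> u v; exact: (@Quotient.pi_add _ (pred_of_vspace U)). Qed.

Definition vquot_scale (a : K) (q : vquot) : vquot := vclass (a *: vrepr q).

Lemma vclassZ (a : K) (v : vT) : vclass (a *: v) = vquot_scale a (vclass v).
Proof.
by apply/eqP; rewrite vclass_eq -scalerBr memvZ // -vclass_eq vreprK.
Qed.

Lemma vquot_scaleA (a b : K) (q : vquot) :
  vquot_scale a (vquot_scale b q) = vquot_scale (a * b) q.
Proof. by rewrite -[q]vreprK -!vclassZ scalerA. Qed.

Lemma vquot_scale1 : left_id 1 vquot_scale.
Proof. by move=> q; rewrite -[q]vreprK -vclassZ scale1r. Qed.

Lemma vquot_scaleDr : right_distributive vquot_scale +%R.
Proof.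
move=> a p q; rewrite -[p]vreprK -[q]vreprK.
by rewrite -vclassD -!vclassZ scalerDr vclassD.
Qed.

Lemma vquot_scaleDl (q : vquot) : {morph vquot_scale^~ q : a b / a + b}.
Proof.
by move=> a b; rewrite -[q]vreprK -!vclassZ scalerDl vclassD.
Qed.

HB.instance Definition _ := GRing.Zmodule_isLmodule.Build K vquot
  vquot_scaleA vquot_scale1 vquot_scaleDr vquot_scaleDl.

Lemma vclass_is_linear : linear vclass.
Proof. by move=> a u v; rewrite vclassD vclassZ. Qed.

HB.instance Definition _ :=
  GRing.isLinear.Build K vT vquot *:%R vclass vclass_is_linear.

(* The quotient is identified with a complement of U. *)
Lemma vquot_vector_axiom : Vector.axiom (\dim U^C) vquot.
Proof.
have capU : (U^C :&: U = 0)%VS by rewrite capvC capv_compl.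
have addU : (U^C + U = fullv)%VS by rewrite addvC addv_complf.
pose p := daddv_pi U^C U.
have p_ker v : v \in U -> p v = 0.
  move=> vU; have := daddv_pi_add (w := v) capU; rewrite addU memvf => /(_ isT).
  rewrite (daddv_pi_id _ vU) 1?capv_compl // => /(canRL (addrK v)).
  by rewrite subrr.
have p_sub v : v - p v \in U.
  have := daddv_pi_add (w := v) capU; rewrite addU memvf => /(_ isT) {1}<-.
  by rewrite addrC addKr memv_pi.
have p_eq q v : vclass v = q -> p (vrepr q) = p v.
  move=> <-; apply/eqP; rewrite -subr_eq0.
  have -> : p (vrepr (vclass v)) - p v = p (vrepr (vclass v) - v).
    by rewrite linearB.
  by rewrite p_ker // -vclass_eq vreprK.
pose b := vbasis U^C.
pose f (q : vquot) := \row_i coord b i (p (vrepr q)).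
exists f.
  move=> a q r; apply/rowP => i; rewrite !mxE -linearP -linearP.
  by rewrite (p_eq _ (a *: vrepr q + vrepr r)) // linearP /= !vreprK.
exists (fun x : 'rV_(\dim U^C) => vclass (\sum_i x 0 i *: b`_i)).
  move=> q; under eq_bigr do rewrite mxE.
  rewrite -coord_vbasis ?memv_pi // -[RHS]vreprK; apply/eqP.
  by rewrite eq_sym vclass_eq.
move=> x; apply/rowP => i; rewrite mxE (p_eq _ (\sum_i x 0 i *: b`_i)) //.
rewrite daddv_pi_id //; last first.
  by apply: memv_suml => j _; rewrite memvZ // vbasis_mem // mem_nth // size_tuple.
by rewrite coord_sum_free // (basis_free (vbasisP _)).
Qed.

HB.instance Definition _ :=
  Lmodule_hasFinDim.Build K vquot vquot_vector_axiom.

Definition vquot_map (f : 'End(vT)) : 'End(vquot) :=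
  linfun (fun q : vquot => vclass (f (vrepr q))).

Lemma vquot_mapE (f : 'End(vT)) (v : vT) :
  (f @: U <= U)%VS -> vquot_map f (vclass v) = vclass (f v).
Proof.
move=> fU.
have fE w : vclass (f (vrepr (vclass w))) = vclass (f w).
  apply/eqP; rewrite vclass_eq -linearB (subvP fU) // memv_img //.
  by rewrite -vclass_eq vreprK.
have lin : linear (fun q : vquot => vclass (f (vrepr q))).
  move=> a p q; rewrite -[p in LHS]vreprK -[q in LHS]vreprK -linearP fE.
  by rewrite !linearP.
pose L := GRing.isLinear.Build K vquot vquot *:%R
  (fun q : vquot => vclass (f (vrepr q))) lin.
pose g : {linear vquot -> vquot} := HB.pack (fun q => vclass (f (vrepr q))) L.
by rewrite /vquot_map (lfunE g) /= fE.
Qed.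

End VectorQuotient.

Definition lftrace (K : fieldType) (vT : vectType K) (f : 'End(vT)) : K :=
  \tr (passmx.mxof (vbasis {:vT}) (vbasis {:vT}) f).

Record sgraph := SGraph {
  vertex :> finType;
  adj : rel vertex;
  adj_sym : symmetric adj;
  adj_irrefl : irreflexive adj
}.

Section Simplices.
Variable G : sgraph.

Definition is_simplex k (x : k.+1.-tuple G) : bool :=
  [forall i, forall j, (i != j) ==> adj (tnth x i) (tnth x j)].

(* Ordered simplices; the entries are distinct since adj is irreflexive. *)
Definition simplex k := {x : k.+1.-tuple G | is_simplex x}.

Lemma reindex_is_simplex k l (x : simplex k) (h : 'I_l.+1 -> 'I_k.+1) :
  injective h -> is_simplex [tuple tnth (val x) (h j) | j < l.+1].
Proof.
move=> h_inj; apply/forallP => i; apply/forallP => j; apply/implyP => ij.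
have /forallP/(_ (h i))/forallP/(_ (h j))/implyP := valP x.
by rewrite !tnth_mktuple (inj_eq h_inj); apply.
Qed.

Definition reindex k l (h : 'I_l.+1 -> 'I_k.+1) (h_inj : injective h)
  (x : simplex k) : simplex l := Sub _ (reindex_is_simplex x h_inj).

Definition simplex_face k (i : 'I_k.+2) : simplex k.+1 -> simplex k :=
  reindex (@lift_inj _ i).

Definition simplex_perm k (s : 'S_k.+1) : simplex k -> simplex k :=
  reindex (@perm_inj _ s).

Definition graph_aut : {set {perm G}} :=
  [set T : {perm G} | [forall x, forall y, adj (T x) (T y) == adj x y]].

Lemma graph_autP (T : {perm G}) :
  reflect (forall x y, adj (T x) (T y) = adj x y) (T \in graph_aut).
Proof.
rewrite inE; apply: (iffP forallP) => [H x y|H x].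
  by have /forallP/(_ y)/eqP := H x.
by apply/forallP => y; rewrite H.
Qed.

Lemma graph_aut_group_set : group_set graph_aut.
Proof.
apply/group_setP; split=> [|S T /graph_autP HS /graph_autP HT].
  by apply/graph_autP => x y; rewrite !perm1.
by apply/graph_autP => x y; rewrite !permM HT HS.
Qed.

Canonical graph_aut_group := Group graph_aut_group_set.

Lemma aut_is_simplex (T : [subg graph_aut]) k (x : simplex k) :
  is_simplex (map_tuple (sgval T) (val x)).
Proof.
apply/forallP => i; apply/forallP => j; rewrite !tnth_map.
have /graph_autP -> := subgP T.
by have /forallP/(_ i)/forallP := valP x.
Qed.

Definition simplex_aut (T : [subg graph_aut]) k (x : simplex k) : simplex k :=
  Sub _ (aut_is_simplex T x).

End Simplices.

Section Cohomology.
Variables (K : fieldType) (G : sgraph).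

Definition cochain k := {ffun simplex G k -> K^o}.
HB.instance Definition _ k := Vector.on (cochain k).

Definition reorder k (s : 'S_k.+1) (f : cochain k) : cochain k :=
  [ffun x => f (simplex_perm s x)].

Lemma reorder_is_linear k s : linear (@reorder k s).
Proof. by move=> a f g; apply/ffunP => x; rewrite !ffunE. Qed.

HB.instance Definition _ k s := GRing.isLinear.Build K (cochain k) (cochain k)
  *:%R (@reorder k s) (@reorder_is_linear k s).

Definition forms k : {vspace cochain k} :=
  (\bigcap_(s : 'S_k.+1) lker (linfun (reorder s) - (-1) ^+ s *: \1%VF)%R)%VS.

Lemma formsP k (f : cochain k) :
  reflect (forall (s : 'S_k.+1) x, f (simplex_perm s x) = (-1) ^+ s * f x)
          (f \in forms k).
Proof.
have kerE (s : 'S_k.+1) :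
  (f \in lker (linfun (reorder s) - (-1) ^+ s *: \1%VF)%R) =
    (reorder s f == (-1) ^+ s *: f).
  by rewrite memv_ker !lfun_simp subr_eq0.
apply: (iffP idP) => [|H]; rewrite memvE.
  move=> /subv_bigcapP H s x; have := H s isT.
  by rewrite -memvE kerE => /eqP/ffunP/(_ x); rewrite !ffunE.
apply/subv_bigcapP => s _; rewrite -memvE kerE.
by apply/eqP/ffunP => x; rewrite !ffunE H.
Qed.

Definition coboundary k (f : cochain k) : cochain k.+1 :=
  [ffun x => \sum_(i < k.+2) (-1) ^+ i * f (simplex_face i x)].

Lemma coboundary_is_linear k : linear (@coboundary k).
Proof.
move=> a f g; apply/ffunP => x; rewrite !ffunE scaler_sumr -big_split /=.
by apply: eq_bigr => i _; rewrite !ffunE mulrDr mulrCA.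
Qed.

HB.instance Definition _ k := GRing.isLinear.Build K (cochain k) (cochain k.+1)
  *:%R (@coboundary k) (@coboundary_is_linear k).

Definition closed_forms k : {vspace cochain k} :=
  (forms k :&: lker (linfun (@coboundary k)))%VS.

Definition exact_forms k : {vspace cochain k} :=
  if k is l.+1 then (linfun (@coboundary l) @: forms l)%VS else 0%VS.

(* Exact forms, as a subspace of the vector space of closed forms. *)
Definition boundaries k : {vspace subvs_of (closed_forms k)} :=
  (linfun vsval @^-1: exact_forms k)%VS.

Definition cohomology k := vquot (boundaries k).
HB.instance Definition _ k := Vector.on (cohomology k).

Section Pullback.
Variable T : [subg graph_aut G].

Definition pullback k (f : cochain k) : cochain k :=
  [ffun x => f (simplex_aut T x)].

Lemma pullback_is_linear k : linear (@pullback k).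
Proof. by move=> a f g; apply/ffunP => x; rewrite !ffunE. Qed.

HB.instance Definition _ k := GRing.isLinear.Build K (cochain k) (cochain k)
  *:%R (@pullback k) (@pullback_is_linear k).

Lemma pullback_forms k f : f \in forms k -> pullback f \in forms k.
Proof.
move=> /formsP Hf; apply/formsP => s x; rewrite !ffunE -Hf; congr (f _).
by apply/val_inj/eq_from_tnth => i; rewrite tnth_map !tnth_mktuple tnth_map.
Qed.

Lemma coboundary_pullback k (f : cochain k) :
  coboundary (pullback f) = pullback (coboundary f).
Proof.
apply/ffunP => x; rewrite !ffunE; apply: eq_bigr => i _; rewrite ffunE.
congr (_ * f _).
by apply/val_inj/eq_from_tnth => j; rewrite tnth_map !tnth_mktuple tnth_map.
Qed.

Lemma pullback_closed k f :
  f \in closed_forms k -> pullback f \in closed_forms k.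
Proof.
rewrite !memv_cap !memv_ker !lfunE /= => /andP[Hf /eqP df0].
by rewrite pullback_forms //= coboundary_pullback df0 linear0.
Qed.

Lemma pullback_exact k f :
  f \in exact_forms k -> pullback f \in exact_forms k.
Proof.
case: k f => [|k] f /=; first by rewrite !memv0 => /eqP ->; rewrite linear0.
move=> /memv_imgP[g Hg ->]; apply/memv_imgP; exists (pullback g).
  exact: pullback_forms.
by rewrite !lfunE /= coboundary_pullback.
Qed.

Definition closed_pullback k (f : subvs_of (closed_forms k)) :
  subvs_of (closed_forms k) := Subvs (pullback_closed (subvsP f)).

Lemma closed_pullback_is_linear k : linear (@closed_pullback k).
Proof. by move=> a f g; apply/val_inj => /=; rewrite linearP. Qed.

HB.instance Definition _ k := GRing.isLinear.Build K
  (subvs_of (closed_forms k)) (subvs_of (closed_forms k)) *:%R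
  (@closed_pullback k) (@closed_pullback_is_linear k).

Lemma closed_pullback_boundaries k :
  (linfun (@closed_pullback k) @: boundaries k <= boundaries k)%VS.
Proof.
apply/subvP => _ /memv_imgP[f Hf ->]; rewrite -memv_preim !lfunE /=.
by apply: pullback_exact; move: Hf; rewrite -memv_preim lfunE.
Qed.

Definition cohomology_map k : 'End(cohomology k) :=
  vquot_map (boundaries k) (linfun (@closed_pullback k)).

Lemma cohomology_mapE k (f : subvs_of (closed_forms k)) :
  cohomology_map k (vclass (boundaries k) f)
    = vclass (boundaries k) (closed_pullback f).
Proof. by rewrite /cohomology_map vquot_mapE ?closed_pullback_boundaries ?lfunE. Qed.

(* G has no k-simplex for k >= #|G|, so the remaining terms are zero. *)
Definition lefschetz : K :=
  \sum_(k < #|G|) (-1) ^+ k * lftrace (cohomology_map k).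

End Pullback.
End Cohomology.

(* Formal power series are given by their sequences of coefficients. *)
Section FormalSeries.
Variable K : fieldType.

Definition fps_one : nat -> K := fun n => (n == 0%N)%:R.

Definition fps_mul (a b : nat -> K) : nat -> K :=
  fun n => \sum_(i < n.+1) a i * b (n - i)%N.

Definition fps_pow (a : nat -> K) (m : nat) : nat -> K :=
  iter m (fps_mul a) fps_one.

(* For a 0 = 0, the coefficient of degree n of a ^ m vanishes when m > n, so
   that this is the exponential series sum_m a ^ m / m!. *)
Definition fps_exp (a : nat -> K) : nat -> K :=
  fun n => \sum_(m < n.+1) fps_pow a m n / m`!%:R.

Definition fps_rational (a : nat -> K) : Prop :=
  exists p q : {poly K},
    q`_0 != 0 /\ fps_mul (fun n => q`_n) a =1 (fun n => p`_n).

End FormalSeries.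

Definition lefschetz_zeta (K : fieldType) (G : sgraph) (T : [subg graph_aut G]) :
  nat -> K :=
  fps_exp (fun n => if n is 0 then 0 else lefschetz K (T ^+ n)%g / n%:R).

(* Main.v *)
Require Import Defs.
From mathcomp Require Import all_boot all_order all_fingroup all_algebra.
From mathcomp Require Import reals.
From mathcomp Require boolp.

(** Let A_k be the matrix of the action of T on the k-th cohomology group.
    Pull-back is functorial, so T ^ n acts by A_k ^ n and
    L(T ^ n) = \sum_k (-1) ^ k \tr (A_k ^ n).  Since
    exp (\sum_(n >= 1) \tr (A ^ n) z ^ n / n) = 1 / det (1 - z A),
    the zeta function is P / Q, where P and Q are the products of the
    polynomials q_k = det (1 - z A_k) over the odd and the even k.

    The identity Q * zeta = P between formal series is obtained by comparing
    logarithmic derivatives z u' / u. Both sides have constant term 1, and in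
    characteristic 0 a series is determined by its constant term and its
    logarithmic derivative ([log_euler_inj]). Logarithmic derivatives turn
    products into sums ([log_eulerM], [log_euler_prod]); that of exp a is z a'
    ([log_euler_exp]); and that of det (1 - z A) is
    - \sum_(n >= 1) \tr (A ^ n) z ^ n ([log_euler_rev_char_poly]), which
    follows from Jacobi's formula for the derivative of a determinant
    ([deriv_det]). *)

Set Implicit Arguments.
Unset Strict Implicit.
Unset Printing Implicit Defensive.

Import GRing.Theory Num.Theory.

Local Open Scope ring_scope.

(** * Formal power series and logarithmic derivatives *)

Section SeriesAlgebra.
Variable K : fieldType.
Implicit Types (a b c s t u v : nat -> K) (p q : {poly K}).

(** A polynomial, seen as a formal power series. *)
Definition fps_of_poly p : nat -> K := fun n => p`_n.

Lemma fps_mul_poly p q :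
  fps_mul (fps_of_poly p) (fps_of_poly q) = fps_of_poly (p * q).
Proof. by apply: boolp.funext => n; rewrite /fps_of_poly coefM. Qed.

(** The product of series agrees with that of their truncations, so that the
    ring laws for series follow from those for polynomials. *)
Lemma fps_mul_trunc N a b n : (n < N)%N ->
  fps_mul a b n = ((\poly_(i < N) a i) * (\poly_(i < N) b i))`_n.
Proof.
move=> nN; rewrite coefM; apply: eq_bigr => i _; rewrite !coef_poly.
have iN : (i < N)%N by apply: leq_ltn_trans nN; rewrite -ltnS.
by rewrite iN (leq_ltn_trans (leq_subr _ _) nN).
Qed.

Lemma fps_mulC : commutative (@fps_mul K).
Proof.
move=> a b; apply: boolp.funext => n.
by rewrite !(fps_mul_trunc _ _ (ltnSn n)) mulrC.
Qed.

Lemma fps_mulA : associative (@fps_mul K).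
Proof.
move=> a b c; apply: boolp.funext => n.
have mulE (x y : nat -> K) i : (i <= n)%N ->
  (\poly_(j < n.+1) fps_mul x y j)`_i =
    (\poly_(j < n.+1) x j * \poly_(j < n.+1) y j)`_i.
  by move=> le_in; rewrite coef_poly ltnS le_in (@fps_mul_trunc n.+1).
rewrite !(fps_mul_trunc _ _ (ltnSn n)).
transitivity ((\poly_(j < n.+1) a j * \poly_(j < n.+1) b j
                * \poly_(j < n.+1) c j)`_n).
  rewrite -mulrA coefM [RHS]coefM; apply: eq_bigr => i _.
  by rewrite mulE // leq_subr.
rewrite coefM [RHS]coefM; apply: eq_bigr => i _.
by rewrite mulE // -ltnS.
Qed.

Lemma fps_mul1 : left_id (@fps_one K) (@fps_mul K).
Proof.
move=> a; apply: boolp.funext => n; rewrite /fps_mul big_ord_recl subn0 mul1r.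
by rewrite big1 ?addr0 // => i _; rewrite mul0r.
Qed.

Lemma fps_mulDl : left_distributive (@fps_mul K) (fun a b => a \+ b).
Proof.
move=> a b c; apply: boolp.funext => n; rewrite /fps_mul /= -big_split /=.
by apply: eq_bigr => i _; rewrite mulrDl.
Qed.

(** The Euler operator z d/dz; unlike d/dz it shifts no index. *)
Definition fps_euler a : nat -> K := fun n => n%:R * a n.

Lemma fps_eulerM a b :
  fps_euler (fps_mul a b) = fps_mul (fps_euler a) b \+ fps_mul a (fps_euler b).
Proof.
apply: boolp.funext => n; rewrite /fps_euler /fps_mul /= mulr_sumr -big_split /=.
apply: eq_bigr => i _.
have {1}-> : n = (i + (n - i))%N by rewrite subnKC // -ltnS.
by rewrite natrD mulrDl mulrA [in X in _ + X]mulrCA.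
Qed.

(** The series s is the logarithmic derivative z u' / u of u, in the
    division-free form z u' = s u. *)
Definition log_euler s u := fps_euler u = fps_mul s u.

Lemma log_eulerM s t u v :
  log_euler s u -> log_euler t v -> log_euler (s \+ t) (fps_mul u v).
Proof.
move=> su tv; rewrite /log_euler fps_eulerM su tv fps_mulDl fps_mulA.
by rewrite [fps_mul t _]fps_mulA [fps_mul t u]fps_mulC -fps_mulA.
Qed.

Lemma log_euler_one : log_euler (fun=> 0) (@fps_one K).
Proof.
apply: boolp.funext => n; rewrite /fps_euler /fps_mul.
rewrite big1 => [|i _]; last by rewrite mul0r.
by case: n => [|n]; rewrite ?mul0r ?mulr0.
Qed.

Lemma log_euler_prod (I : Type) (r : seq I) (P : pred I) (s : I -> nat -> K)
    (q : I -> {poly K}) :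
  (forall i, log_euler (s i) (fps_of_poly (q i))) ->
  log_euler (fun n => \sum_(i <- r | P i) s i n)
    (fps_of_poly (\prod_(i <- r | P i) q i)).
Proof.
move=> sq; elim: r => [|i r IHr].
  rewrite big_nil (_ : fps_of_poly 1 = @fps_one K); last first.
    by apply: boolp.funext => n; rewrite /fps_of_poly coef1.
  rewrite (_ : (fun _ => _) = (fun=> 0)); first exact: log_euler_one.
  by apply: boolp.funext => n; rewrite big_nil.
rewrite big_cons; case: ifP => Pi.
  rewrite -fps_mul_poly; have := log_eulerM (sq i) IHr.
  congr log_euler; apply: boolp.funext => n.
  by rewrite big_cons Pi.
move: IHr; congr log_euler; apply: boolp.funext => n.
by rewrite big_cons Pi.
Qed.

Lemma fps_powS a m : fps_pow a m.+1 = fps_mul a (fps_pow a m).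
Proof. by []. Qed.

Lemma fps_pow_small a m n : a 0%N = 0 -> (n < m)%N -> fps_pow a m n = 0.
Proof.
move=> a0; elim: m n => // m IHm n nm; rewrite fps_powS /fps_mul.
rewrite big1 // => i _; case: (posnP i) => [->|i_gt0]; first by rewrite a0 mul0r.
rewrite IHm ?mulr0 //; apply: leq_trans (nm : (n <= m)%N).
by rewrite ltn_subrL i_gt0 (leq_trans i_gt0) // -ltnS.
Qed.

(** The power rule z (a ^ (m + 1))' = (m + 1) (z a') a ^ m. *)
Lemma fps_euler_pow a m n :
  fps_euler (fps_pow a m.+1) n =
    m.+1%:R * fps_mul (fps_euler a) (fps_pow a m) n.
Proof.
elim: m n => [|m IHm] n.
  by rewrite fps_powS /= [fps_mul a _]fps_mulC fps_mul1 mul1r fps_mulC fps_mul1.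
rewrite fps_powS fps_eulerM /=.
rewrite (_ : fps_euler (fps_mul a (fps_pow a m)) =
   fun n => m.+1%:R * fps_mul (fps_euler a) (fps_pow a m) n); last first.
  by apply: boolp.funext => k; rewrite -fps_powS IHm.
have mulZ (c : K) b : fps_mul a (fun n => c * b n) n = c * fps_mul a b n.
  by rewrite /fps_mul mulr_sumr; apply: eq_bigr => i _; rewrite mulrCA.
have mulCA u v : fps_mul a (fps_mul u v) = fps_mul u (fps_mul a v).
  by rewrite !fps_mulA (fps_mulC a).
by rewrite mulZ mulCA [m.+2%:R]mulrSr mulrDl mul1r addrC.
Qed.

End SeriesAlgebra.

Section CharZero.
Variable K : numFieldType.

(** The equation z u' = s u is the recursion
    n u_n = \sum_(0 < i <= n) s_i u_(n - i), in which n is invertible. *)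
Lemma log_euler_inj (s u v : nat -> K) : s 0%N = 0 -> u 0%N = v 0%N ->
  log_euler s u -> log_euler s v -> u =1 v.
Proof.
move=> s0 uv0 su sv n; elim/ltn_ind: n => -[|n] // IHn.
apply: (mulfI (x := n.+1%:R)); first by rewrite pnatr_eq0.
have := congr1 (@^~ n.+1) su; have := congr1 (@^~ n.+1) sv.
rewrite /fps_euler /fps_mul /= => -> ->.
rewrite big_ord_recl [in RHS]big_ord_recl s0 !mul0r; congr (_ + _).
by apply: eq_bigr => i _; rewrite IHn // subSS ltnS leq_subr.
Qed.

Lemma log_euler_exp (a : nat -> K) :
  a 0%N = 0 -> log_euler (fps_euler a) (fps_exp a).
Proof.
move=> a0; apply: boolp.funext => n; rewrite {1}/fps_euler {1}/fps_exp mulr_sumr.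
(* Any longer range of summation gives the same exponential series. *)
have fpsE N k : (k < N)%N ->
  fps_exp a k = \sum_(m < N) fps_pow a m k / m`!%:R.
  move=> kN; rewrite /fps_exp.
  rewrite (big_ord_widen _ (fun m => fps_pow a m k / m`!%:R) kN) big_mkcond.
  apply: eq_bigr => m _; case: ifPn => //.
  by rewrite ltnS -ltnNge => km; rewrite fps_pow_small // mul0r.
rewrite big_ord_recl.
have -> : n%:R * (fps_pow a (ord0 : 'I_n.+1) n / 0`!%:R) = 0.
  case: n fpsE => [|n] _; first by rewrite mul0r.
  by rewrite /= /fps_one /= mul0r mulr0.
rewrite add0r.
under eq_bigr => m _.
  rewrite mulrA -[n%:R * _]/(fps_euler (fps_pow a m.+1) n) fps_euler_pow.
  rewrite factS natrM invfM mulrA.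
  rewrite [_ * fps_mul _ _ _]mulrC mulfK ?pnatr_eq0 //; over.
rewrite /fps_mul; under eq_bigr do rewrite mulr_suml.
rewrite exchange_big; apply: eq_bigr => i _ /=.
(* For i = 0 the range m < n is too short, but the term vanishes. *)
case: (posnP i) => [->|i_gt0].
  have e0 : fps_euler a 0 = 0 by exact: mul0r.
  by rewrite e0 mul0r big1 // => m _; rewrite !mul0r.
rewrite (fpsE n) ?mulr_sumr; last first.
  by rewrite ltn_subrL i_gt0 (leq_trans i_gt0) // -ltnS.
by apply: eq_bigr => m _; rewrite mulrA.
Qed.

End CharZero.

(** * Newton's identities *)

Section Newton.

Lemma deriv_prod (R : comNzRingType) (I : eqType) (r : seq I)
    (F : I -> {poly R}) :
  uniq r -> (\prod_(i <- r) F i)^`() =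
    \sum_(i <- r) (F i)^`() * \prod_(j <- r | j != i) F j.
Proof.
elim: r => [|x r IHr] /=; first by rewrite !big_nil derivC.
case/andP=> xr ur; rewrite !big_cons derivM IHr // eqxx /=; congr (_ * _ + _).
  rewrite big_seq [RHS]big_seq_cond; apply: eq_big => [j|//].
  by case: eqVneq => [->|]; rewrite ?(negPf xr) ?andbT.
rewrite mulr_sumr; apply: eq_big_seq => i ir.
have xi : x != i by apply: contraNneq xr => ->.
by rewrite big_cons xi mulrCA.
Qed.

(** Jacobi's formula for the derivative of a determinant. *)
Lemma deriv_det (R : comNzRingType) n (M : 'M[{poly R}]_n) :
  (\det M)^`() = \tr (map_mx (@deriv R) M *m \adj M).
Proof.
(* The matrix M with its row i differentiated. *)
pose Mi i := \matrix_(k, j) (if k == i then (M i j)^`() else M k j).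
transitivity (\sum_i \det (Mi i)).
  rewrite /determinant raddf_sum exchange_big /=; apply: eq_bigr => s _.
  rewrite -mulr_sumr !mulr_sign (fun_if (@deriv R)) derivN.
  suff -> : (\prod_i M i (s i))^`() = \sum_j \prod_i Mi j i (s i) by [].
  rewrite deriv_prod ?index_enum_uniq //.
  apply: eq_bigr => i _.
  rewrite [RHS](bigD1 i) //= mxE eqxx; congr (_ * _).
  by apply: eq_bigr => j /negPf ji; rewrite mxE ji.
apply: eq_bigr => i _; rewrite (expand_det_row _ i) mxE; apply: eq_bigr => j _.
rewrite !mxE eqxx; congr (_ * _); rewrite /cofactor; congr (_ * \det _).
by apply/matrixP=> k l; rewrite !mxE eq_sym (negPf (neq_lift _ _)).
Qed.

Variable K : fieldType.

(** The reciprocal characteristic polynomial det (1 - z A). *)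
Definition rev_char_poly n (A : 'M[K]_n) : {poly K} :=
  \det (1%:M - 'X *: map_mx polyC A).

Lemma rev_char_poly0 n (A : 'M[K]_n) : (rev_char_poly A)`_0 = 1.
Proof.
rewrite -horner_coef0 -[_.[0]]/(horner_eval 0 _) -det_map_mx.
rewrite (_ : map_mx _ _ = 1%:M) ?det1 //; apply/matrixP=> i j.
by rewrite !mxE rmorphB rmorphM rmorph_nat /= /horner_eval hornerX mul0r subr0.
Qed.

(** Newton's identities: z q' = - (\sum_(k >= 1) \tr (A ^ k) z ^ k) q for
    q = det (1 - z A). The reason is that q' = - \tr (A *m \adj (1 - z A)),
    while \adj (1 - z A) = q \sum_k z ^ k A ^ k. *)
Lemma log_euler_rev_char_poly n (A : 'M[K]_n) :
  log_euler (fun k => if k is 0 then 0 else - \tr (A ^+ k))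
    (fps_of_poly (rev_char_poly A)).
Proof.
set q := rev_char_poly A; pose M : 'M[{poly K}]_n := 1%:M - 'X *: map_mx polyC A.
(* The coefficient of z ^ k in the adjugate. *)
pose B k : 'M[K]_n := map_mx (coefp k) (\adj M).
have adjE : \adj M = q%:M + 'X *: (map_mx polyC A *m \adj M).
  by rewrite -[q%:M](mul_mx_adj M) mulmxBl mul1mx -scalemxAl subrK.
have coefAM k : map_mx (coefp k) (map_mx polyC A *m \adj M) = A *m B k.
  apply/matrixP=> i j; rewrite !mxE raddf_sum; apply: eq_bigr => l _.
  by rewrite !mxE /= coefCM.
have BE k : B k = \sum_(i < k.+1) q`_(k - i) *: A ^+ i.
  elim: k => [|k IHk].
    rewrite big_ord1 expr0 /B adjE; apply/matrixP=> i j.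
    by rewrite !mxE /= coefD coefXM addr0 coefMn mulr_natr.
  have -> : B k.+1 = q`_k.+1 *: 1%:M + A *m B k.
    rewrite -coefAM /B {1}adjE; apply/matrixP=> i j.
    by rewrite !mxE /= coefD coefXM coefMn mulr_natr.
  rewrite IHk [RHS]big_ord_recl subn0 expr0 mulmx_sumr; congr (_ + _).
  by apply: eq_bigr => i _; rewrite -scalemxAr exprS.
apply: boolp.funext => -[|k]; rewrite /fps_euler /fps_mul.
  by rewrite big_ord1 !mul0r.
rewrite big_ord_recl mul0r add0r /fps_of_poly mulr_natl -coef_deriv.
rewrite deriv_det.
have -> : map_mx (@deriv K) M = - map_mx polyC A.
  apply/matrixP=> i j; rewrite !mxE derivB derivMn derivC mul0rn sub0r.
  by rewrite derivM derivX derivC mulr0 addr0 mul1r.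
rewrite mulNmx linearN coefN.
have -> : (\tr (map_mx polyC A *m \adj M))`_k = \tr (A *m B k).
  by rewrite -coefAM /mxtrace coef_sum; apply: eq_bigr => i _; rewrite [RHS]mxE.
rewrite BE mulmx_sumr linear_sum -sumrN; apply: eq_bigr => i _ /=.
by rewrite -scalemxAr linearZ /= subSS [RHS]mulrC mulrN exprS.
Qed.

End Newton.

(** * The Lefschetz number as an alternating sum of traces *)

Section LefschetzTrace.
Variables (K : fieldType) (G : sgraph).
Implicit Types (S T : [subg graph_aut G]).

Lemma cohomology_map1 k : cohomology_map K (1%g : [subg graph_aut G]) k = \1%VF.
Proof.
apply/lfunP => q; rewrite id_lfunE -[q]vreprK cohomology_mapE; congr vclass.
apply/val_inj/ffunP => x; rewrite ffunE; congr (_ _).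
by apply/val_inj/eq_from_tnth => i; rewrite tnth_map morph1 perm1.
Qed.

(** Permutations are multiplied from left to right, hence pull-back, which is
    contravariant, preserves the order of S and T here. *)
Lemma cohomology_mapM S T k :
  cohomology_map K (S * T)%g k = (cohomology_map K S k \o cohomology_map K T k)%VF.
Proof.
apply/lfunP => q; rewrite comp_lfunE -[q]vreprK !cohomology_mapE; congr vclass.
apply/val_inj/ffunP => x; rewrite !ffunE; congr (_ _).
apply/val_inj/eq_from_tnth => i; rewrite !tnth_map.
by rewrite morphM ?in_setT // permM.
Qed.

(** The matrix of the action of T on the k-th cohomology group, in the basis
    used by [lftrace]. *)
Definition cohomology_mx T k :=
  passmx.mxof (vbasis {:cohomology K G k}) (vbasis {:cohomology K G k})
    (cohomology_map K T k).

Lemma cohomology_mxX T k n : cohomology_mx (T ^+ n)%g k = cohomology_mx T k ^+ n.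
Proof.
have bas := vbasisP {:cohomology K G k}.
elim: n => [|n IHn].
  rewrite expg0 expr0 /cohomology_mx cohomology_map1.
  by rewrite passmx.mxof1 ?(basis_free bas).
(* Matrices act on row vectors, so that composition reverses their order. *)
rewrite expgSr exprS -IHn /cohomology_mx cohomology_mapM.
by rewrite (passmx.mxof_comp _ _ bas).
Qed.

Lemma lefschetzX T n :
  lefschetz K (T ^+ n)%g =
    \sum_(k < #|G|) (-1) ^+ k * \tr (cohomology_mx T k ^+ n).
Proof. by apply: eq_bigr => k _; rewrite -cohomology_mxX. Qed.

End LefschetzTrace.

(** * Rationality *)

(** Rationality of the zeta function of a finite family of matrices, taken
    with alternating signs. *)
Lemma fps_rational_exp_tr (K : numFieldType) (m : nat) (d : 'I_m -> nat)
    (A : forall k, 'M[K]_(d k)) :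
  fps_rational (fps_exp (fun n =>
    if n is 0 then 0
    else (\sum_(k < m) (-1) ^+ k * \tr (A k ^+ n)) / n%:R)).
Proof.
set a := fun n : nat => _.
pose q k := rev_char_poly (A k).
pose t (k : 'I_m) n := if n is 0 then 0 else - \tr (A k ^+ n).
have qt k : log_euler (t k) (fps_of_poly (q k)) by exact: log_euler_rev_char_poly.
pose Q := \prod_(k < m | ~~ odd k) q k; pose P := \prod_(k < m | odd k) q k.
have coef0 (C : pred 'I_m) : (\prod_(k < m | C k) q k)`_0 = 1.
  rewrite -horner_coef0 horner_prod big1 // => k _.
  by rewrite horner_coef0 rev_char_poly0.
have expa0 : fps_exp a 0%N = 1 by rewrite /fps_exp big_ord1 /= /fps_one divr1.
exists P, Q; split; first by rewrite coef0 oner_neq0.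
have logP := log_euler_prod (index_enum _) (fun k => odd (k : 'I_m)) qt.
have logQ := log_euler_prod (index_enum _) (fun k => ~~ odd (k : 'I_m)) qt.
apply: (log_euler_inj _ _ _ logP).
- by rewrite big1.
- by rewrite /fps_mul big_ord1 expa0 mulr1 /Q /fps_of_poly !coef0.
(* The terms of even index k in z a' cancel the logarithmic derivative of Q. *)
have := log_eulerM logQ (log_euler_exp (a := a) (erefl _)).
congr log_euler; apply: boolp.funext => -[|n] /=.
  by rewrite !big1 // /fps_euler mul0r addr0.
rewrite /fps_euler /a mulrC divfK ?pnatr_eq0 //.
rewrite [X in _ + X](bigID (fun k : 'I_m => odd k)) /= addrCA -[RHS]addr0.
congr (_ + _).
  by apply: eq_bigr => k ok; rewrite -signr_odd ok mulN1r.
rewrite -big_split big1 //= => k /negPf ek.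
by rewrite -signr_odd ek mul1r addNr.
Qed.

Theorem proposition6p1 (R : realType) (G : sgraph) (T : [subg graph_aut G]) :
  fps_rational (lefschetz_zeta R T).
Proof.
have := fps_rational_exp_tr (fun k : 'I_#|G| => cohomology_mx R T k).
congr (fps_rational (fps_exp _)); apply: boolp.funext => -[|n] //.
by rewrite lefschetzX.
Qed.
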